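(* Let $\alpha=2k+1\ge5$ be odd, $\varepsilon=e^{\pi i/(2\alpha)}$, $\zeta_j=\varepsilon^{2j-1}$ for $j=1,\dots,2\alpha$ (the roots of $z^{2\alpha}=-1$), and for $\mu>0$ let $A_\alpha(\mu)$ be the $2\alpha\times2\alpha$ matrix with $(r,j)$ entry $\zeta_j^{\,r-1}$ for $1\le r\le\alpha$ and $\zeta_j^{\,r-\alpha-1}e^{\mu\zeta_j}$ for $\alpha+1\le r\le 2\alpha$. Put $c_\ell=\cos\frac{\ell\pi}{2\alpha}$, $s_\ell=\sin\frac{\ell\pi}{2\alpha}$, $\sigma=2\sum_{j=1}^{k-2}c_{2j-1}$ (an empty sum being $0$), and $$\gamma_1=\sigma+2c_{2k-3}+2c_{2k-1},\quad \gamma_2=\sigma+2c_{2k-3}+c_{2k-1},\quad \gamma_3=\sigma+c_{2k-3}+2c_{2k-1}.$$ Then there are nonzero constants $K_1,K_2$ with $-K_2/K_1=2/\sin^2\frac{\pi}{2\alpha}$ such that, as $\mu\to+\infty$, $$\det A_\alpha(\mu)=K_1e^{\gamma_1\mu}\sin\mu+K_2e^{\gamma_2\mu}\sin(s_{2k-1}\mu)+O\big(e^{\gamma_3\mu}\big).$$ *)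

(* Defs.v *)
From HB Require Import structures.
From mathcomp Require Import all_boot all_order all_algebra.
From mathcomp Require Import complex.
From mathcomp Require Import reals.
From mathcomp.analysis Require Import sequences exp trigo.
Set Implicit Arguments. Unset Strict Implicit. Unset Printing Implicit Defensive.
Import Order.TTheory GRing.Theory Num.Theory.
Local Open Scope ring_scope.
Local Open Scope complex_scope.

Section Defs.
Variable R : realType.

Definition cexp (z : R[i]) : R[i] :=
  let: a +i* b := z in (expR a)%:C * (cos b +i* sin b).

Definition cmod (z : R[i]) : R := let: a +i* b := z in Num.sqrt (a ^+ 2 + b ^+ 2).

Definition eps (alpha : nat) : R[i] := cexp (0 +i* (pi / (2 * alpha)%:R)).

(* zeta_{j+1} = eps^(2(j+1)-1) = eps^(2j+1), for 0-based j : 'I_(2 alpha) *)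
Definition zeta (alpha : nat) (j : 'I_(2 * alpha)) : R[i] := eps alpha ^+ (2 * j + 1).

(* A_alpha(mu), 0-based row index r (paper's row r+1) *)
Definition Amat (alpha : nat) (mu : R) : 'M[R[i]]_(2 * alpha) :=
  \matrix_(r < 2 * alpha, j < 2 * alpha)
    (if (r < alpha)%N then zeta j ^+ r
     else zeta j ^+ (r - alpha) * cexp (mu%:C * zeta j)).

Definition cl (alpha l : nat) : R := cos (l%:R * pi / (2 * alpha)%:R).
Definition sl (alpha l : nat) : R := sin (l%:R * pi / (2 * alpha)%:R).

Definition sigma (k : nat) : R :=
  2 * \sum_(1 <= j < k.-1) cl (2 * k + 1) (2 * j - 1).

Definition gamma1 (k : nat) : R :=
  sigma k + 2 * cl (2 * k + 1) (2 * k - 3) + 2 * cl (2 * k + 1) (2 * k - 1).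
Definition gamma2 (k : nat) : R :=
  sigma k + 2 * cl (2 * k + 1) (2 * k - 3) + cl (2 * k + 1) (2 * k - 1).
Definition gamma3 (k : nat) : R :=
  sigma k + cl (2 * k + 1) (2 * k - 3) + 2 * cl (2 * k + 1) (2 * k - 1).

End Defs.

(* Main.v *)
Require Import Defs.
From HB Require Import structures.
From mathcomp Require Import all_boot all_order all_algebra.
From mathcomp Require Import complex.
From mathcomp Require Import reals.
From mathcomp.analysis Require Import sequences exp trigo.
From mathcomp Require Import perm.
From mathcomp Require Import zify ring lra.
Import Order.TTheory GRing.Theory Num.Theory.
Local Open Scope ring_scope.
Local Open Scope complex_scope.

(** Expanding det A along columns gives the sum over the column sets S with alpha
elements of exp(mu * sum_S zeta) times the minor f(S), and f(S) is the full Vandermonde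
determinant divided by the product of the differences zeta_s - zeta_t, s in S, t not
in S.  Let P be the 2k roots in the open right half plane.  The real part of
sum_S zeta equals gamma1 minus the sum of |Re zeta_j| over the symmetric difference of S
and P, so it exceeds gamma3 only for six sets: P + {x} for x = i, -i, w or its
conjugate, and P - {y} + {i, -i} for y = -w or its conjugate, where w is the root next
to i on the left.  As prod_(t <> x) (x - t) = -2 alpha / x, the
minor of P + {x} is a constant times
x^alpha (prod_(j <= k) (x + 1/x - 2 c_(2j-1)))^2, and the last two minors reduce to this
form by complementation and negation.  The ratio of the two products is evaluated with
c_a + c_b = 2 c_((a+b)/2) c_((a-b)/2) and prod_(l <= k) (2 c_(2l))^2 = 1. *)

Set Implicit Arguments.
Unset Strict Implicit.
Unset Printing Implicit Defensive.

(** * Vandermonde minors *)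

Section BlockVandermonde.
Variables (F : fieldType) (m : nat) (z : 'I_(2 * m) -> F).

Definition block_vandermonde (x : 'I_(2 * m) -> F) : 'M[F]_(2 * m) :=
  \matrix_(r, j) (if (r < m)%N then z j ^+ r else z j ^+ (r - m) * x j).

(** When S has m elements the determinant of this matrix is, up to sign, the product of the
    Vandermonde determinants of S and of its complement. Keeping the full size avoids following that
    sign. *)
Definition split_vandermonde (S : {set 'I_(2 * m)}) : 'M[F]_(2 * m) :=
  \matrix_(r, j) (if (r < m)%N then (z j ^+ r) *+ (j \notin S)
                  else (z j ^+ (r - m)) *+ (j \in S)).

Definition cross_diff (S : {set 'I_(2 * m)}) : F :=
  \prod_(s in S) \prod_(t | t \notin S) (z s - z t).

(** Multilinearity: each column is the sum of its upper half and of [x j] times its lower half, and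
    S records the columns where the lower half is chosen. *)
Lemma det_block_vandermonde x :
  \det (block_vandermonde x) =
  \sum_(S : {set 'I_(2 * m)}) (\prod_(s in S) x s) * \det (split_vandermonde S).
Proof.
rewrite -det_tr /determinant.
under eq_bigr => s _.
  under eq_bigr => i _.
    have -> : (block_vandermonde x)^T i (s i) =
       (if (s i < m)%N then 0 else z i ^+ (s i - m) * x i) +
       (if (s i < m)%N then z i ^+ (s i) else 0).
      by rewrite !mxE; case: ifP; rewrite ?add0r ?addr0.
    over.
  rewrite bigA_distr mulr_sumr; over.
rewrite exchange_big /=; apply: eq_bigr => S _.
rewrite -/(determinant _) -det_tr mulr_sumr; apply: eq_bigr => s _.
rewrite mulrCA; congr (_ * _).
rewrite (big_mkcond (mem S)) -big_split /=; apply: eq_bigr => i _.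
rewrite !mxE; case: (i \in S); case: ifP => _ //=;
  by rewrite ?mulr1n ?mulr0n ?mulr0 ?mul1r // mulrC.
Qed.

Lemma card_ord_ltn : #|[set r : 'I_(2 * m) | (r < m)%N]| = m.
Proof.
have lem : (m <= 2 * m)%N by lia.
rewrite -sum1_card; under eq_bigl => i do rewrite inE.
by rewrite (big_ord_narrow lem) sum1_card card_ord.
Qed.

(** A permutation with a nonzero Leibniz term sends the m lower rows exactly onto S, which forces S
    to have m elements. *)
Lemma det_split_vandermonde_eq0 (S : {set 'I_(2 * m)}) :
  #|S| <> m -> \det (split_vandermonde S) = 0.
Proof.
move=> cardS; rewrite /determinant big1 // => s _.
apply/eqP; rewrite mulf_eq0; apply/orP; right.
have [/forallP h|] := boolP [forall r, (s r \in S) == (m <= r)%N].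
  case: cardS; rewrite -(card_imset _ (@perm_inj _ s^-1)).
  have -> : [set (s^-1)%g x | x in S] = ~: [set r : 'I_(2 * m) | (r < m)%N].
    apply/setP => r; rewrite !inE -leqNgt -(eqP (h r)).
    by rewrite -{1}(permK s r) mem_imset //; apply: perm_inj.
  by rewrite cardsCs setCK card_ord card_ord_ltn mul2n -addnn addnK.
rewrite negb_forall => /existsP[r hr]; rewrite (bigD1 r) //= !mxE.
by move: hr; rewrite leqNgt; case: (r < m)%N; case: (s r \in S); rewrite //= mul0r.
Qed.

Lemma det_split_vandermonde (S : {set 'I_(2 * m)}) : #|S| = m ->
  cross_diff S * \det (split_vandermonde S) =
  \prod_(i < 2 * m) \prod_(j < 2 * m | (i < j)%N) (z j - z i).
Proof.
move=> cardS.
(* The unitriangular row operations [z ^ (m + r) -> z ^ r * p(z)] turn the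
   Vandermonde matrix into [block_vandermonde (p \o z)], and [p] kills every
   column set not contained in [S]. *)
pose p : {poly F} := \prod_(t | t \notin S) ('X - (z t)%:P).
have monp : p \is monic by apply: monic_prod_XsubC.
have szp : size p = m.+1.
  rewrite /p -big_filter size_prod_XsubC size_filter -sum1_count.
  under eq_bigl => i do rewrite -in_setC.
  by rewrite sum1_card; have := cardsC S; rewrite cardS card_ord; lia.
have rootp t : t \notin S -> p.[z t] = 0.
  by move=> tS; rewrite horner_prod (bigD1 t) //= hornerXsubC subrr mul0r.
pose q (i : 'I_(2 * m)) : {poly F} := if (i < m)%N then 'X^i else 'X^(i - m) * p.
have szq i : size (q i) = i.+1.
  rewrite /q; case: ltnP => him; first by rewrite size_polyXn.
  by rewrite size_monicM ?monicXn ?monic_neq0 // size_polyXn szp; lia.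
have monq i : q i \is monic.
  by rewrite /q; case: ifP; rewrite ?monicXn // monicMl ?monicXn.
pose L : 'M[F]_(2 * m) := \matrix_(i, c) (q i)`_c.
have detL : \det L = 1.
  rewrite det_trig.
    by apply: big1 => i _; rewrite mxE -(monicP (monq i)) /lead_coef szq.
  by apply/is_trig_mxP => i c ic; rewrite mxE nth_default // szq.
have LV : L *m Vandermonde (2 * m) (\row_j z j) =
    block_vandermonde (fun j => p.[z j]).
  apply/matrixP => i j; rewrite !mxE.
  transitivity ((q i).[z j]).
    rewrite (@horner_coef_wide _ (2 * m)) ?szq ?ltn_ord //.
    by apply: eq_bigr => c _; rewrite !mxE.
  by rewrite /q; case: ifP; rewrite ?hornerM hornerXn.
have := congr1 determinant LV; rewrite det_mulmx detL mul1r det_Vandermonde.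
rewrite det_block_vandermonde (bigD1 S) //= [X in _ + X]big1 ?addr0.
  rewrite /cross_diff => detV; transitivity (\prod_(i < 2 * m)
      \prod_(j < 2 * m | (i < j)%N) ((\row_j0 z j0) 0 j - (\row_j0 z j0) 0 i)).
    rewrite detV; congr (_ * _); apply: eq_bigr => s _.
    by rewrite horner_prod; apply: eq_bigr => t _; rewrite hornerXsubC.
  by apply: eq_bigr => i _; apply: eq_bigr => j _; rewrite !mxE.
(* A set U of size m other than S has an element outside S, where [p] vanishes. *)
move=> U neqUS; have [cardU|/eqP cardU] := eqVneq #|U| m; last first.
  by rewrite det_split_vandermonde_eq0 // mulr0.
have /subsetPn[s sU sS] : ~~ (U \subset S).
  by apply: contra neqUS => US; rewrite eqEcard US cardS cardU leqnn.
by rewrite (bigD1 s) //= rootp // !mul0r.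
Qed.
End BlockVandermonde.

(** * Products of differences of roots *)

Section CrossDiff.
Variables (F : fieldType) (m : nat) (z : 'I_(2 * m) -> F).

(** Negating the roots reverses each difference, and passing to the complement reverses it back, so
    no sign is left. *)
Lemma cross_diff_opp_compl (nu : 'I_(2 * m) -> 'I_(2 * m))
    (S T : {set 'I_(2 * m)}) :
  involutive nu -> (forall j, z (nu j) = - z j) ->
  (forall j, (nu j \in T) = (j \notin S)) -> cross_diff z T = cross_diff z S.
Proof.
move=> nuK znu memT; rewrite /cross_diff.
have nuI : {on [pred i | i \in T], bijective nu} by apply: onW_bij; exists nu.
rewrite (reindex nu) //=; under eq_bigl => j do rewrite memT.
under eq_bigr => j jS.
  rewrite (reindex nu) /=; last by apply: onW_bij; exists nu.
  under eq_bigl => t do rewrite memT negbK.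
  over.
rewrite exchange_big /=; apply: eq_bigr => t tS; apply: eq_bigr => j jS.
by rewrite !znu; ring.
Qed.

(** Adding x to P drops the factors [z s - z x] and creates the factors [z x - z t] with t outside
    P. Of the two copies of the squared product, one restores the dropped factors up to sign, the
    other completes the product over all [t != x]. *)
Lemma cross_diff_setU1 (P : {set 'I_(2 * m)}) x : x \notin P ->
  cross_diff z (x |: P) * (\prod_(s in P) (z x - z s)) ^+ 2 =
  (-1) ^+ #|P| * (\prod_(s in P) \prod_(t | t \notin P) (z s - z t)) *
  \prod_(t | t != x) (z x - z t).
Proof.
move=> xP; rewrite /cross_diff big_setU1 //=.
have -> : \prod_(s in P) \prod_(t | t \notin P) (z s - z t) =
    ((-1) ^+ #|P| * \prod_(s in P) (z x - z s)) *
    \prod_(s in P) \prod_(t | t \notin x |: P) (z s - z t).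
  rewrite -prodr_const -!big_split /=; apply: eq_bigr => s sP.
  rewrite (bigD1 x) //= mulN1r opprB; congr (_ * _).
  by apply: eq_bigl => t; rewrite !inE negb_or andbC.
have -> : \prod_(t | t != x) (z x - z t) =
    \prod_(s in P) (z x - z s) * \prod_(t | t \notin x |: P) (z x - z t).
  rewrite (bigID (mem P)) /=; congr (_ * _); apply: eq_bigl => t; rewrite ?inE.
    by case: eqVneq => //= ->; rewrite (negPf xP).
  by rewrite negb_or.
have : ((-1) ^+ #|P|) ^+ 2 = 1 :> F by rewrite -signr_odd sqrr_sign.
set s := (-1) ^+ _ => s2; set p := \prod_(s in P) (z x - z s).
by ring: s2.
Qed.

(** Both sides are the derivative at [w i] of X^n + 1, which factors as the product of the X -
    w_j. *)
Lemma prod_root_diff (n : nat) (w : 'I_n -> F) i :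
  injective w -> (forall j, w j ^+ n = -1) ->
  \prod_(t | t != i) (w i - w t) = n%:R * w i ^+ n.-1.
Proof.
move=> wI wn.
have n0 : (0 < n)%N by case: n i {w wI wn} => [[]|].
have E : 'X^n + 1 = \prod_(j < n) ('X - (w j)%:P) :> {poly F}.
  have sz : size ('X^n + 1 : {poly F}) = n.+1 by rewrite size_XnaddC.
  have := @all_roots_prod_XsubC F ('X^n + 1) [seq w j | j <- enum 'I_n].
  rewrite sz size_map size_enum_ord (monicP (monicXnaddC _ _)) // scale1r.
  rewrite uniq_rootsE map_inj_uniq // enum_uniq big_map big_enum /=; apply => //.
  by apply/allP => _ /mapP[j _ ->]; rewrite rootE !hornerE wn addNr.
have := congr1 (fun p => p^`().[w i]) E => /=.
rewrite derivD derivXn derivC addr0 hornerMn hornerXn -mulr_natl => ->.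
rewrite [X in _ = X^`().[_]](bigD1 i) //= derivM derivXsubC mul1r.
rewrite hornerD hornerM hornerXsubC subrr mul0r addr0.
by rewrite horner_prod; apply: eq_bigr => t _; rewrite hornerXsubC.
Qed.

End CrossDiff.

(** * The roots of z^(2 alpha) = -1 *)

Section UnitCircle.
Variable R : realType.

Lemma cexpD (x y : R[i]) : cexp (x + y) = cexp x * cexp y.
Proof.
case: x y => [a b] [c d]; rewrite /cexp /= expRD cosD sinD.
by apply/eqP; rewrite eq_complex /=; apply/andP; split; apply/eqP; ring.
Qed.

Lemma cexp0 : cexp (0 : R[i]) = 1.
Proof. by rewrite /cexp /= expR0 cos0 sin0 mul1r. Qed.

Lemma cexp_sum (I : Type) (r : seq I) (P : pred I) (f : I -> R[i]) :
  cexp (\sum_(i <- r | P i) f i) = \prod_(i <- r | P i) cexp (f i).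
Proof. exact: (big_morph _ cexpD cexp0). Qed.

Lemma cmod_cexp (x : R[i]) : cmod (cexp x) = expR (complex.Re x).
Proof.
case: x => a b; rewrite /cexp /cmod /= !mul0r subr0 addr0.
by rewrite !exprMn -mulrDr cos2Dsin2 mulr1 sqrtr_sqr ger0_norm // expR_ge0.
Qed.

Lemma cmodE (x : R[i]) : (cmod x)%:C = `|x|.
Proof. by rewrite normc_def; case: x. Qed.

Lemma cmodM (x y : R[i]) : cmod (x * y) = cmod x * cmod y.
Proof. by apply: complexI; rewrite rmorphM /= !cmodE normrM. Qed.

Lemma cmod_sum (I : Type) (r : seq I) (P : pred I) (f : I -> R[i]) :
  cmod (\sum_(i <- r | P i) f i) <= \sum_(i <- r | P i) cmod (f i).
Proof.
rewrite -lecR cmodE rmorph_sum /=; under [leRHS]eq_bigr => i _ do rewrite cmodE.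
exact: ler_norm_sum.
Qed.

Variable alpha : nat.
Hypothesis alpha_gt0 : (0 < alpha)%N.
Local Notation eps := (eps R alpha).
Local Notation cl := (cl R alpha).
Local Notation sl := (sl R alpha).

Lemma eps_expE l : eps ^+ l = cl l +i* sl l.
Proof.
rewrite /Defs.cl /Defs.sl; elim: l => [|l IH].
  by rewrite expr0 !mul0r cos0 sin0.
rewrite exprSr IH /Defs.eps /cexp expR0 mul1r -natr1 [in RHS]mulrDl [in RHS]mulrDl.
rewrite !mul1r; move: (l%:R * pi / _) (pi / _) => t u; rewrite cosD sinD.
by apply/eqP; rewrite eq_complex /=; apply/andP; split; apply/eqP; ring.
Qed.

Lemma alpha_neq0 : alpha%:R != 0 :> R.
Proof. by rewrite pnatr_eq0; lia. Qed.

Lemma eps_exp_alpha : eps ^+ alpha = 'i.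
Proof.
rewrite eps_expE /Defs.cl /Defs.sl.
have -> : alpha%:R * pi / (2 * alpha)%:R = pi / 2 :> R.
  by rewrite natrM; field; rewrite alpha_neq0.
by rewrite cos_pihalf sin_pihalf.
Qed.

Lemma eps_exp_2alpha : eps ^+ (2 * alpha) = -1.
Proof. by rewrite mulnC exprM eps_exp_alpha sqr_i. Qed.

Lemma eps_exp_4alpha : eps ^+ (4 * alpha) = 1.
Proof.
have -> : (4 * alpha = 2 * alpha * 2)%N by lia.
by rewrite exprM eps_exp_2alpha sqrrN expr1n.
Qed.

Lemma cl_decr l l' : (l <= l' <= 2 * alpha)%N -> cl l' <= cl l.
Proof.
move=> /andP[ll' l'a]; rewrite /Defs.cl le_eqVlt; apply/orP.
move: ll'; rewrite leq_eqVlt => /orP[/eqP ->|ll']; [by left|right].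
have p0 := @pi_gt0 R.
have q0 : 0 < (2 * alpha)%:R :> R by rewrite ltr0n; lia.
have bnd j : (j <= 2 * alpha)%N -> j%:R * pi / (2 * alpha)%:R \in `[0, pi : R].
  move=> ja; rewrite in_itv /= divr_ge0 ?mulr_ge0 ?ler0n ?(ltW p0) //=.
  by rewrite ler_pdivrMr // mulrC ler_pM2l // ler_nat.
rewrite ltr_cos ?bnd //; last by lia.
by rewrite ltr_pM2r ?invr_gt0 // ltr_pM2r // ltr_nat.
Qed.

Lemma cl_gt0 l : (l < alpha)%N -> 0 < cl l.
Proof.
move=> la; rewrite /Defs.cl; apply: cos_gt0_pihalf.
have p0 := @pi_gt0 R.
have q0 : 0 < (2 * alpha)%:R :> R by rewrite ltr0n; lia.
apply/andP; split.
  by rewrite (@lt_le_trans _ _ 0) ?oppr_lt0 ?divr_gt0 // divr_ge0 ?mulr_ge0 ?ler0n // ltW.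
rewrite ltr_pdivrMr // natrM mulrA divfK ?pnatr_eq0 // [ltRHS]mulrC.
by rewrite ltr_pM2r // ltr_nat.
Qed.

Lemma cl_alpha : cl alpha = 0.
Proof. by have := eps_expE alpha; rewrite eps_exp_alpha => -[]. Qed.

Lemma eps_neq0 : eps != 0.
Proof.
apply/eqP => e0; have := eps_exp_4alpha; rewrite e0 expr0n.
have -> : (4 * alpha == 0)%N = false by lia.
by move/eqP; rewrite eq_sym oner_eq0.
Qed.

(** By the half angle formula 1 - cos 2x = 2 sin^2 x, with x strictly between 0 and pi. *)
Lemma cl_neq1 l : (0 < l < 4 * alpha)%N -> cl l != 1.
Proof.
move=> /andP[l0 l4]; rewrite /Defs.cl.
have p0 := @pi_gt0 R.
have q0 : 0 < (4 * alpha)%:R :> R by rewrite ltr0n; lia.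
have -> : l%:R * pi / (2 * alpha)%:R = (l%:R * pi / (4 * alpha)%:R) *+ 2 :> R.
  by rewrite !natrM -mulr_natl; field; rewrite alpha_neq0.
set x := l%:R * pi / _.
have : 0 < sin x.
  apply: sin_gt0_pi; rewrite divr_gt0 ?mulr_gt0 ?(ltr0n _ l) //=.
  by rewrite ltr_pdivrMr // mulrC ltr_pM2l // ltr_nat.
rewrite cos_mulr2n cos2sin2 => sx; apply/eqP => h.
have : sin x ^+ 2 > 0 by rewrite exprn_gt0.
by lra.
Qed.

(** A smaller order d would give [cl d = 1], against [cl_neq1]. *)
Lemma eps_prim : (4 * alpha).-primitive_root eps.
Proof.
have n0 : (0 < 4 * alpha)%N by lia.
have [d dprim ddiv] := prim_order_exists n0 eps_exp_4alpha.
have d0 := prim_order_gt0 dprim.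
have [//|dlt] : d = (4 * alpha)%N \/ (d < 4 * alpha)%N.
- by have := dvdn_leq n0 ddiv; lia.
- by move=> <-.
have /eqP := prim_expr_order dprim; rewrite eps_expE eq_complex /= => /andP[c1 _].
by have := @cl_neq1 d; rewrite d0 dlt c1 => /(_ isT).
Qed.

Lemma cl_opp l l' : (l + l' = 4 * alpha)%N -> cl l = cl l'.
Proof.
move=> h; rewrite /Defs.cl -[in RHS]cosN -[in RHS]cosD2pi; congr cos.
have -> : l%:R = 4 * alpha%:R - l'%:R :> R by rewrite -natrM -h natrD addrK.
by rewrite natrM -[pi *+ 2]mulr_natl; field; rewrite alpha_neq0.
Qed.

Lemma cl_supp l l' : (l + l' = 2 * alpha)%N -> cl l = - cl l'.
Proof.
move=> h; rewrite /Defs.cl -[in RHS]cosN -cosDpi; congr cos.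
have -> : l%:R = 2 * alpha%:R - l'%:R :> R by rewrite -natrM -h natrD addrK.
by rewrite natrM; field; rewrite alpha_neq0.
Qed.

End UnitCircle.

(** * Cosine and sine identities *)

Section Trig.
Variables (R : realType) (alpha : nat).
Hypothesis alpha_gt0 : (0 < alpha)%N.
Local Notation eps := (eps R alpha).
Local Notation cl := (cl R alpha).
Local Notation sl := (sl R alpha).

Lemma cl0 : cl 0 = 1.
Proof. by rewrite /Defs.cl !mul0r cos0. Qed.

Lemma cl_le1 l : cl l <= 1.
Proof. exact: cos_le1. Qed.

Lemma cl_ge0 l : (l <= alpha)%N -> 0 <= cl l.
Proof.
rewrite leq_eqVlt => /orP[/eqP ->|/cl_gt0 h]; last by rewrite ltW ?h.
by rewrite cl_alpha.
Qed.

Lemma cl_addB l m : (m <= l)%N -> cl (l + m) + cl (l - m) = 2 * cl l * cl m.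
Proof.
move=> ml; rewrite /Defs.cl natrD natrB // !mulrDl !mulNr cosD cosB; ring.
Qed.

Lemma sl_supp l l' : (l + l' = 2 * alpha)%N -> sl l = sl l'.
Proof.
move=> h; rewrite /Defs.sl -[RHS]opprK -sinN -sinDpi; congr sin.
have -> : l%:R = 2 * alpha%:R - l'%:R :> R by rewrite -natrM -h natrD addrK.
by rewrite natrM; field; rewrite alpha_neq0.
Qed.

Lemma cl_halfturn l : cl (2 * alpha + l) = - cl l.
Proof.
rewrite /Defs.cl -cosDpi; congr cos.
by rewrite natrD natrM; field; rewrite alpha_neq0.
Qed.

Lemma eps_exp_addV l : eps ^+ l + (eps ^+ l)^-1 = (2 * cl l)%:C.
Proof.
have -> : (eps ^+ l)^-1 = cl l -i* sl l.
  apply: (mulfI (expf_neq0 l (eps_neq0 R alpha_gt0))).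
  rewrite mulfV ?expf_neq0 ?eps_neq0 // eps_expE.
  have h := cos2Dsin2 (l%:R * pi / (2 * alpha)%:R : R).
  rewrite -/(cl l) -/(sl l) in h; apply/eqP; rewrite eq_complex /=.
  by apply/andP; split; apply/eqP; [rewrite -h|]; ring.
by rewrite eps_expE; apply/eqP; rewrite eq_complex /=; apply/andP; split; apply/eqP; ring.
Qed.

End Trig.

(** This grouping from both ends and the grouping by neighbours below are the two ways in which
    [prod_cl_ratio] reads one product of cosines. *)
Lemma big_ord_double_fold (T : Type) (idx : T) (op : Monoid.com_law idx) k
    (F : nat -> T) :
  \big[op/idx]_(l < k + k) F l =
  \big[op/idx]_(j < k) op (F j) (F (k + k - j.+1)%N).
Proof.
rewrite big_split_ord big_split /=; congr (op _ _).
rewrite (reindex_inj rev_ord_inj) /=; apply: eq_bigr => j _; congr F.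
by have := ltn_ord j; lia.
Qed.

Lemma big_ord_double_pair (T : Type) (idx : T) (op : Monoid.com_law idx) k
    (F : nat -> T) :
  \big[op/idx]_(l < k + k) F l =
  \big[op/idx]_(j < k) op (F (2 * j)%N) (F (2 * j + 1)%N).
Proof.
elim: k => [|k IH]; first by rewrite !big_ord0.
have -> : (k.+1 + k.+1 = (k + k).+2)%N by lia.
rewrite 3!big_ord_recr /= IH -Monoid.mulmA; congr (op _ (op (F _) (F _))); lia.
Qed.

(** * Products of cosines for odd alpha *)

Section OddTrig.
Variables (R : realType) (k : nat).
Local Notation alpha := (2 * k + 1)%N.
Local Notation eps := (eps R alpha).
Local Notation cl := (cl R alpha).
Local Notation sl := (sl R alpha).

Let alpha_gt0 : (0 < alpha)%N. Proof. by rewrite addn1. Qed.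

(** [eps ^+ 4] is a primitive root of unity of odd order alpha. Evaluating the factorisation of
    X^alpha - 1 at -1 gives 1 for the product of the -1 - e over the nontrivial roots e, and the
    factors of e and 1/e multiply to 2 + e + 1/e, the square of twice a cosine of even index. *)
Lemma prod_cl_even : \prod_(j < k) (2 * cl (2 * j + 2)) ^+ 2 = 1.
Proof.
have prim : (k + k).+1.-primitive_root (eps ^+ 4).
  have := @dvdn_prim_root _ _ _ (eps_prim R alpha_gt0) (k + k).+1.
  have -> : (4 * alpha = 4 * (k + k).+1)%N by lia.
  by rewrite mulnK //; apply; apply: dvdn_mull.
have := congr1 (fun p => p.[-1]) (factor_Xn_sub_1 prim).
rewrite /= horner_prod big_mkord big_ord_recl /= hornerXsubC expr0 hornerE hornerXn.
have -> : (-1) ^+ (k + k).+1 = -1 :> R[i] by rewrite -signr_odd /= addnn odd_double.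
rewrite !hornerE.
rewrite -[X in _ = X]mulr1 => /mulfI h.
have {}h : \prod_(i < k + k) (-1 - (eps ^+ 4) ^+ i.+1) = 1.
  rewrite -[RHS]h; first by rewrite addnn -mul2n; apply: eq_bigr => i _; rewrite hornerXsubC.
  by rewrite -opprD oppr_eq0 (pnatr_eq0 _ 2).
apply: complexI; rewrite rmorph1 -[RHS]h.
rewrite (big_ord_double_fold _ k (fun i => -1 - (eps ^+ 4) ^+ i.+1)) rmorph_prod /=.
apply: eq_bigr => j _.
have -> : (eps ^+ 4) ^+ (k + k - j.+1).+1 = ((eps ^+ 4) ^+ j.+1)^-1.
  apply: (mulfI (expf_neq0 j.+1 (expf_neq0 4 (eps_neq0 R alpha_gt0)))).
  rewrite -exprD mulfV ?expf_neq0 ?eps_neq0 //.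
  have -> : (j.+1 + (k + k - j.+1).+1 = alpha)%N by have := ltn_ord j; lia.
  by rewrite -exprM eps_exp_4alpha.
rewrite -exprM; set e := eps ^+ (4 * j.+1).
have e0 : e != 0 by rewrite expf_neq0 ?eps_neq0.
have -> : (-1 - e) * (-1 - e^-1) = 2 + (e + e^-1) by field.
rewrite eps_exp_addV // -(rmorph_nat (real_complex R) 2) -rmorphD /=; congr (_%:C).
have := @cl_addB R alpha (2 * j + 2) (2 * j + 2) (leqnn _).
rewrite subnn cl0 (_ : (2 * j + 2 + (2 * j + 2) = 4 * j.+1)%N); last by lia.
by move=> h1; rewrite -[cl (4 * _)](addrK 1) h1; ring.
Qed.

Lemma cl_2k : cl (2 * k) = sin (pi / (2 * alpha)%:R).
Proof.
rewrite -cosBpihalf /Defs.cl -[in RHS]cosN; congr cos.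
rewrite !natrM natrD natrM; field.
by rewrite -natrM natr1 pnatr_eq0.
Qed.

(** This yields the ratio of the two leading coefficients. Sum-to-product turns the left product
    into 4^k c_0 ... c_(2k-1) ([E1]). Since c_0 = 1 and the sine is c_(2k), one factor of it shifts
    the range to 1..2k ([E2]), where the even indices are evaluated by [prod_cl_even]. *)
Lemma prod_cl_ratio :
  \prod_(j < k) (2 * cl (2 * k - 1) + 2 * cl (2 * j + 1)) ^+ 2 *
    sin (pi / (2 * alpha)%:R) ^+ 2 =
  \prod_(j < k) (2 * cl (2 * j + 1)) ^+ 2.
Proof.
(* At k = 0, where [2 * k - 1] is truncated, the products are empty and the sine is 1. *)
have [->|k0] := posnP k.
  by rewrite !big_ord0 muln0 add0n muln1 sin_pihalf mul1r expr1n.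
have E1 : \prod_(j < k) (2 * cl (2 * k - 1) + 2 * cl (2 * j + 1)) =
    4 ^+ k * \prod_(l < k + k) cl l.
  rewrite (big_ord_double_fold _ k cl) (reindex_inj rev_ord_inj) /=.
  rewrite -[k in 4 ^+ k]card_ord -prodr_const -big_split /=.
  apply: eq_bigr => j _; have jk := ltn_ord j.
  have h : (j <= k + k - j.+1)%N by lia.
  have := @cl_addB R alpha _ _ h.
  have -> : (k + k - j.+1 + j = 2 * k - 1)%N by lia.
  have -> : (k + k - j.+1 - j = 2 * (k - j.+1) + 1)%N by lia.
  by move=> {}h; rewrite -mulrDr h; ring.
have E2 : (\prod_(l < k + k) cl l) * sin (pi / (2 * alpha)%:R) =
    \prod_(j < k) (cl (2 * j + 1) * cl (2 * j + 2)).
  rewrite -cl_2k [X in cl X](_ : 2 * k = k + k)%N; last by lia.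
  transitivity (\prod_(l < (k + k).+1) cl l); first by rewrite [RHS]big_ord_recr.
  rewrite big_ord_recl /= cl0 mul1r.
  rewrite (big_ord_double_pair _ k (fun l => cl l.+1)) /=.
  by apply: eq_bigr => j _; congr (cl _ * cl _); lia.
rewrite prodrXl E1 exprMn -mulrA -exprMn E2 big_split /=.
have E3 := prod_cl_even; rewrite prodrXl big_split /= prodr_const card_ord in E3.
rewrite prodrXl [in RHS]big_split /= prodr_const card_ord.
rewrite [in LHS](_ : 4 ^+ k = 2 ^+ k * 2 ^+ k :> R); last by rewrite -exprMn -natrM.
set X := \prod_(j < k) cl (2 * j + 1); set Y := \prod_(j < k) cl (2 * j + 2) in E3 *.
transitivity ((2 ^+ k * X) ^+ 2 * (2 ^+ k * Y) ^+ 2); first by ring.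
by rewrite E3 mulr1.
Qed.

End OddTrig.

(** * The dominant column sets *)

Section ColumnSets.
Variables (k : nat).
Hypothesis hk : (2 <= k)%N.
Local Notation alpha := (2 * k + 1)%N.
Local Notation idx := 'I_(2 * alpha).

(* Columns are indexed from 0, so column [j] carries the root of angle
   [(2 j + 1) pi / (2 alpha)]: [idx_i] carries 'i, [idx_pos] and [idx_neg] carry
   the roots just before and just after it, and [rev_ord] is conjugation. *)
Lemma idx_i_subproof : (k < 2 * alpha)%N. Proof. lia. Qed.
Lemma idx_pos_subproof : (k.-1 < 2 * alpha)%N. Proof. lia. Qed.
Lemma idx_neg_subproof : (k.+1 < 2 * alpha)%N. Proof. lia. Qed.

Definition idx_i : idx := Ordinal idx_i_subproof.
Definition idx_pos : idx := Ordinal idx_pos_subproof.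
Definition idx_neg : idx := Ordinal idx_neg_subproof.

Lemma idx_half_turn_subproof (j : idx) : ((j + alpha) %% (2 * alpha) < 2 * alpha)%N.
Proof. by rewrite ltn_mod; lia. Qed.
Definition half_turn (j : idx) : idx := Ordinal (idx_half_turn_subproof j).

Lemma val_half_turn (j : idx) :
  half_turn j = (if (j < alpha)%N then j + alpha else j - alpha)%N :> nat.
Proof.
have := ltn_ord j; rewrite /=; case: ifP => h1 h2; first by rewrite modn_small //; lia.
have -> : (j + alpha = (j - alpha) + 2 * alpha)%N by lia.
by rewrite modnDr modn_small //; lia.
Qed.

Lemma half_turnK : involutive half_turn.
Proof.
move=> j; apply: val_inj; rewrite [val _]val_half_turn val_half_turn.
by have := ltn_ord j; case: (ltnP j alpha) => h1 h2; case: ifP => h3 /=; lia.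
Qed.

(** The columns of the roots with positive real part: the first k and their conjugates. Columns k
    and 3k + 1, carrying i and -i, are excluded. *)
Definition right_half : {set idx} := [set j : idx | (j < k)%N || (3 * k + 1 < j)%N].

Lemma mem_right_half (j : idx) :
  (j \in right_half) = (j < k)%N || (3 * k + 1 < j)%N.
Proof. by rewrite inE. Qed.

Lemma le_k_idx : (k <= 2 * alpha)%N. Proof. lia. Qed.

Lemma big_right_half (T : Type) (u : T) (op : Monoid.com_law u) (F : idx -> T) :
  \big[op/u]_(j in right_half) F j =
  \big[op/u]_(j < k) op (F (widen_ord le_k_idx j)) (F (rev_ord (widen_ord le_k_idx j))).
Proof.
rewrite (bigID (fun j : idx => (j < k)%N)) big_split /=; congr (op _ _).
  rewrite -(big_ord_narrow (F := F) le_k_idx); apply: eq_bigl => j.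
  by rewrite mem_right_half; case: ltnP; rewrite ?andbF.
rewrite (reindex_inj rev_ord_inj).
rewrite -(big_ord_narrow (F := fun j => F (rev_ord j)) le_k_idx); apply: eq_bigl => j.
by rewrite mem_right_half /=; have := ltn_ord j; lia.
Qed.

Lemma card_right_half : #|right_half| = (2 * k)%N.
Proof. by rewrite -sum1_card big_right_half /= sum_nat_const card_ord mulnC. Qed.

(** The order matters: [drop 2] removes i and -i and leaves the four roots closest to the imaginary
    axis but not on it. *)
Definition near_imaginary : seq idx :=
  [:: idx_i; rev_ord idx_i; idx_pos; rev_ord idx_pos; idx_neg; rev_ord idx_neg].

Lemma mem_near_imaginary (j : idx) : (j \in near_imaginary) =
  [|| j == k :> nat, j == 3 * k + 1 :> nat, j == k.-1 :> nat, j == 3 * k + 2 :> nat,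
     j == k.+1 :> nat | j == 3 * k :> nat]%N.
Proof. by rewrite !inE -!val_eqE /=; lia. Qed.

Lemma uniq_near_imaginary : uniq near_imaginary.
Proof. by rewrite /= !inE -!val_eqE /=; lia. Qed.

(* The first two sets maximise the real part [gamma1] of the exponent, the other
   four give the second largest value [gamma2]. *)
Definition main_cols : seq {set idx} :=
  [:: idx_i |: right_half; rev_ord idx_i |: right_half;
      idx_neg |: right_half; rev_ord idx_neg |: right_half;
      idx_i |: (rev_ord idx_i |: right_half :\ idx_pos);
      idx_i |: (rev_ord idx_i |: right_half :\ rev_ord idx_pos)].

(* Traces on [near_imaginary]: all the sets compared here agree with
   [right_half] elsewhere. *)
Definition col_key (S : {set idx}) : seq bool := [seq (j \in S) | j <- near_imaginary].

Definition main_keys : seq (seq bool) :=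
  [:: [:: true; false; true; true; false; false];
      [:: false; true; true; true; false; false];
      [:: false; false; true; true; true; false];
      [:: false; false; true; true; false; true];
      [:: true; true; false; true; false; false];
      [:: true; true; true; false; false; false] ].

Lemma col_key_main_cols : map col_key main_cols = main_keys.
Proof.
by do 6!(congr cons; first by rewrite /col_key /= !inE -!val_eqE /=; do 6!(congr cons; first lia)).
Qed.

Lemma uniq_main_cols : uniq main_cols.
Proof. by apply: (@map_uniq _ _ col_key); rewrite col_key_main_cols. Qed.

Lemma card_main_cols (S : {set idx}) : S \in main_cols -> #|S| = alpha.
Proof.
have c1 x : x \notin right_half -> #|x |: right_half| = alpha.
  by move=> h; rewrite cardsU1 h card_right_half; lia.
have c2 x : x \in right_half -> #|idx_i |: (rev_ord idx_i |: right_half :\ x)| = alpha.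
  move=> h; rewrite cardsU1 cardsU1; have := cardsD1 x right_half.
  rewrite h card_right_half !inE -!val_eqE /=.
  move: h; rewrite inE; move: (ltn_ord x) #|_| => xlt c h eqc.
  by do 2!(rewrite (_ : ~~ _ = true); last lia); lia.
by rewrite !inE => /or4P[|||/or3P[]] /eqP ->; (apply: c1 || apply: c2); rewrite inE /=; lia.
Qed.

Lemma col_key_inj (S T : {set idx}) :
  (forall j, j \notin near_imaginary -> (j \in S) = (j \in right_half)) ->
  (forall j, j \notin near_imaginary -> (j \in T) = (j \in right_half)) ->
  col_key S = col_key T -> S = T.
Proof.
move=> hS hT hST; apply/setP => j; have [jn|jn] := boolP (j \in near_imaginary).
  by move/eq_in_map: hST => /(_ j jn).
by rewrite hS // hT.
Qed.

Lemma main_cols_far S j : S \in main_cols -> j \notin near_imaginary ->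
  (j \in S) = (j \in right_half).
Proof.
rewrite mem_near_imaginary => hS hj.
by move: hS; rewrite !inE => /or4P[|||/or3P[]] /eqP ->; rewrite !inE -!val_eqE /=; lia.
Qed.

(** S can differ from [right_half] only at i, -i and at most one of the four neighbouring roots, so
    its cardinality leaves a finite check on six membership bits. *)
Lemma mem_main_cols (S : {set idx}) : #|S| = alpha ->
  (forall j, j \notin near_imaginary -> (j \in S) = (j \in right_half)) ->
  (forall i j, i \in drop 2 near_imaginary -> j \in drop 2 near_imaginary -> i != j ->
     ((i \in S) == (i \in right_half)) || ((j \in S) == (j \in right_half))) ->
  S \in main_cols.
Proof.
move=> cardS farS nearS.
suff keyS : col_key S \in main_keys.
  move: keyS; rewrite -col_key_main_cols => /mapP[T TM eqST].
  by rewrite (col_key_inj farS _ eqST) // => j; apply: main_cols_far.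
(* Away from [near_imaginary], S consists of the 2k - 2 elements of [right_half] other than
   [idx_pos] and its conjugate, so 3 of its 2k + 1 elements remain. *)
have cardkey : count id (col_key S) = 3.
  have := cardS; rewrite -(cardsID [set j in near_imaginary] S).
  have -> : #|S :&: [set j in near_imaginary]| = count id (col_key S).
    rewrite count_map -size_filter.
    rewrite -(card_uniqP (filter_uniq _ uniq_near_imaginary)).
    by apply: eq_card => j; rewrite in_setI [_ \in [set _ in _]]in_set mem_filter.
  have -> : #|S :\: [set j in near_imaginary]| =
            #|right_half :\: [set idx_pos; rev_ord idx_pos]|.
    apply: eq_card => j; rewrite [in LHS]inE [in RHS]inE inE.
    have [jn|jn] := boolP (j \in near_imaginary); last first.
      rewrite farS //= andbC; case: (boolP (j \in right_half)) => //= _.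
      by move: jn; rewrite mem_near_imaginary !inE -!val_eqE /=; lia.
    by move: jn; rewrite mem_near_imaginary !inE -!val_eqE /=; lia.
  rewrite cardsD (_ : right_half :&: _ = [set idx_pos; rev_ord idx_pos]); last first.
    by apply/setP => j; rewrite !inE -!val_eqE /=; lia.
  rewrite cards2 card_right_half -val_eqE /=; lia.
have mem_rh : [/\ idx_pos \in right_half, rev_ord idx_pos \in right_half,
    idx_neg \notin right_half & rev_ord idx_neg \notin right_half].
  by rewrite !inE /=; split; lia.
case: mem_rh => m1 m2 m3 m4.
pose agree j := (j \in S) == (j \in right_half).
have {}nearS i j : i \in drop 2 near_imaginary -> j \in drop 2 near_imaginary ->
  i != j -> agree i || agree j by exact: nearS.
have := nearS idx_pos (rev_ord idx_pos); have := nearS idx_pos idx_neg.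
have := nearS idx_pos (rev_ord idx_neg); have := nearS (rev_ord idx_pos) idx_neg.
have := nearS (rev_ord idx_pos) (rev_ord idx_neg); have := nearS idx_neg (rev_ord idx_neg).
have := uniq_near_imaginary; rewrite /= !inE !negb_or !eqxx ?orbT /=.
rewrite /agree m1 m2 (negPf m3) (negPf m4).
move=> /and5P[_ _ /and3P[-> -> ->] /andP[-> ->] /andP[-> _]].
move=> /(_ isT isT isT) h1 /(_ isT isT isT) h2 /(_ isT isT isT) h3
  /(_ isT isT isT) h4 /(_ isT isT isT) h5 /(_ isT isT isT) h6.
move: cardkey h1 h2 h3 h4 h5 h6; rewrite /col_key /=.
by do 6!case: (_ \in S).
Qed.

End ColumnSets.

(** * Asymptotics of the determinant *)

Section Roots.
Variables (R : realType) (k : nat).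
Hypothesis hk : (2 <= k)%N.
Local Notation alpha := (2 * k + 1)%N.
Local Notation idx := 'I_(2 * alpha).
Local Notation eps := (eps R alpha).
Local Notation cl := (cl R alpha).
Local Notation sl := (sl R alpha).
Local Notation z := (@zeta R alpha).
Local Notation right_half := (right_half k).
Local Notation a := (idx_i hk).
Local Notation p := (idx_pos hk).
Local Notation n := (idx_neg hk).
Local Notation rev := (@rev_ord (2 * alpha)).

Let alpha_gt0 : (0 < alpha)%N. Proof. by rewrite addn1. Qed.

Lemma zetaE j : z j = cl (2 * j + 1) +i* sl (2 * j + 1).
Proof. by rewrite /zeta eps_expE. Qed.

Lemma zeta_neq0 j : z j != 0.
Proof. by rewrite expf_neq0 // eps_neq0. Qed.

Lemma zeta_rev j : z (rev j) = (z j)^-1.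
Proof.
apply: (mulIf (zeta_neq0 j)); rewrite mulVf ?zeta_neq0 // /zeta -exprD /=.
have -> : (2 * (2 * alpha - j.+1) + 1 + (2 * j + 1) = 4 * alpha)%N.
  by have := ltn_ord j; lia.
by rewrite eps_exp_4alpha.
Qed.

Lemma zeta_half_turn j : z (half_turn hk j) = - z j.
Proof.
rewrite /zeta val_half_turn; case: ltnP => ja.
  have -> : (2 * (j + alpha) + 1 = 2 * alpha + (2 * j + 1))%N by lia.
  by rewrite exprD eps_exp_2alpha // mulN1r.
have -> : (2 * j + 1 = 2 * alpha + (2 * (j - alpha) + 1))%N by lia.
by rewrite [in RHS]exprD eps_exp_2alpha // mulN1r opprK.
Qed.

Lemma zeta_inj : injective z.
Proof.
move=> i j /eqP; rewrite (eq_prim_root_expr (eps_prim R alpha_gt0)).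
rewrite !modn_small; [|have := ltn_ord j; lia|have := ltn_ord i; lia].
by move=> /eqP h; apply: val_inj => /=; lia.
Qed.

Lemma zeta_exp j : z j ^+ (2 * alpha) = -1.
Proof.
rewrite /zeta exprAC eps_exp_2alpha // -signr_odd.
by rewrite oddD oddM expr1.
Qed.

Lemma zeta_i : z a = 'i%C.
Proof. by rewrite /zeta eps_exp_alpha. Qed.

Lemma zeta_Ni : z (rev a) = - 'i%C.
Proof.
rewrite zeta_rev zeta_i; apply/eqP; rewrite eq_complex /=.
by apply/andP; split; apply/eqP; field.
Qed.

Lemma zeta_addV j : z j + (z j)^-1 = (2 * cl (2 * j + 1))%:C.
Proof. exact: eps_exp_addV. Qed.

Lemma gamma1E : gamma1 R k = \sum_(j < k) 2 * cl (2 * j + 1).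
Proof.
rewrite /gamma1 /sigma; case: k hk => [|[|m]] // _.
rewrite -[RHS](big_mkord xpredT (fun j => 2 * Defs.cl R (2 * m.+2 + 1) (2 * j + 1))).
rewrite [RHS]big_nat_recr //= [X in _ = X + _]big_nat_recr //=.
congr (_ + _ * Defs.cl _ _ _ + _ * Defs.cl _ _ _); try lia.
rewrite mulr_sumr big_add1 /=; apply: eq_bigr => j _; congr (_ * Defs.cl _ _ _); lia.
Qed.

Lemma sum_zeta_right_half : \sum_(j in right_half) z j = (gamma1 R k)%:C.
Proof.
rewrite big_right_half gamma1E rmorph_sum; apply: eq_bigr => j _ /=.
by rewrite zeta_rev zeta_addV.
Qed.

Lemma cl_2k1_ge0 : 0 <= cl (2 * k - 1).
Proof. by apply: cl_ge0 => //; lia. Qed.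

(** As c_(2k+1) = 0, the left side equals 2 c_(2k-1) c_2. Hence changing two of the four neighbours
    of i and -i costs at least gamma1 - gamma3. *)
Lemma cl_2k3_le : cl (2 * k - 3) <= 2 * cl (2 * k - 1).
Proof.
have h : (2 <= 2 * k - 1)%N by lia.
have := @cl_addB R alpha _ _ h.
have -> : (2 * k - 1 + 2 = alpha)%N by lia.
have -> : (2 * k - 1 - 2 = 2 * k - 3)%N by lia.
rewrite cl_alpha // add0r => ->; rewrite ler_piMr ?cl_le1 //.
by rewrite mulr_ge0 ?cl_2k1_ge0.
Qed.

(* Equal to [|Re (zeta j)|]: what the real part of the exponent loses, compared with
   [right_half], when column [j] is added or removed. *)
Definition re_gap (j : idx) : R :=
  if j \in right_half then cl (2 * j + 1) else - cl (2 * j + 1).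

(** Here m is the index [2 * j + 1] folded into the first quadrant, with one case per quadrant. *)
Lemma re_gapE (j : idx) : exists m, [/\ (m <= alpha)%N, re_gap j = cl m &
  (j \notin near_imaginary hk -> m <= 2 * k - 3)%N /\
  (j \in drop 2 (near_imaginary hk) -> m = 2 * k - 1)%N].
Proof.
have jlt := ltn_ord j.
have mem_drop2 : (j \in drop 2 (near_imaginary hk)) =
    [|| j == k.-1 :> nat, j == 3 * k + 2 :> nat, j == k.+1 :> nat | j == 3 * k :> nat]%N.
  by rewrite /= !inE -!val_eqE /=; lia.
rewrite /re_gap mem_right_half mem_near_imaginary mem_drop2.
have [j1|j1] := ltnP j k; first by exists (2 * j + 1)%N; split => //; lia.
rewrite /=; case: (ltnP (3 * k + 1) j) => j2.
  exists (4 * alpha - (2 * j + 1))%N; split; [lia| |lia].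
  by apply: cl_opp => //; lia.
have [j3|j3] := ltnP j alpha.
  exists (2 * alpha - (2 * j + 1))%N; split; [lia| |lia].
  by rewrite (@cl_supp _ _ alpha_gt0 _ (2 * alpha - (2 * j + 1))) ?opprK //; lia.
exists (2 * j + 1 - 2 * alpha)%N; split; [lia| |lia].
rewrite [in LHS](_ : 2 * j + 1 = 2 * alpha + (2 * j + 1 - 2 * alpha))%N; last by lia.
by rewrite cl_halfturn // opprK.
Qed.

Lemma re_gap_ge0 j : 0 <= re_gap j.
Proof. by have [m [ma -> _]] := re_gapE j; apply: cl_ge0. Qed.

Lemma re_gap_far j : j \notin near_imaginary hk -> cl (2 * k - 3) <= re_gap j.
Proof.
move=> jn; have [m [ma -> [/(_ jn) h _]]] := re_gapE j.
by apply: cl_decr => //; rewrite h; lia.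
Qed.

Lemma re_gap_near j : j \in drop 2 (near_imaginary hk) -> re_gap j = cl (2 * k - 1).
Proof. by move=> jn; have [m [ma -> [_ /(_ jn) ->]]] := re_gapE j. Qed.

Lemma re_sum_zeta (S : {set idx}) :
  complex.Re (\sum_(j in S) z j) =
  gamma1 R k - \sum_(j | (j \in S) != (j \in right_half)) re_gap j.
Proof.
have ReD : {morph @complex.Re R : x y / x + y >-> x + y} by case=> ? ? [].
have Re_sum (U : {set idx}) : complex.Re (\sum_(j in U) z j) = \sum_(j in U) cl (2 * j + 1).
  by rewrite (big_morph _ ReD (erefl _)); apply: eq_bigr => j _; rewrite zetaE.
have /(congr1 (@complex.Re R)) := sum_zeta_right_half; rewrite Re_sum /= => <-.
rewrite Re_sum [LHS]big_mkcond [X in _ = X - _]big_mkcond [X in _ = _ - X]big_mkcond.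
rewrite -sumrB; apply: eq_bigr => j _.
by rewrite /re_gap; case: (j \in S); case: (j \in right_half) => /=;
  rewrite ?subr0 ?subrr ?sub0r ?opprK.
Qed.

(** By contraposition: above gamma3 the total gap is less than c_(2k-3), which rules out a change at
    a far column and changes at two of the four near ones. Columns i and -i are left
    unconstrained. *)
Lemma re_sum_zeta_le (S : {set idx}) : #|S| = alpha -> S \notin main_cols hk ->
  complex.Re (\sum_(j in S) z j) <= gamma3 R k.
Proof.
move=> cardS; apply: contraR; rewrite -ltNge re_sum_zeta => lt_gap.
have gap3 : gamma3 R k = gamma1 R k - cl (2 * k - 3).
  by rewrite /gamma3 /gamma1; ring.
have {lt_gap gap3} gap_lt :
    \sum_(j | (j \in S) != (j \in right_half)) re_gap j < cl (2 * k - 3).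
  by rewrite gap3 in lt_gap; lra.
apply: mem_main_cols => // [j jn|i j ir jr ij].
  apply/eqP; apply: contraLR gap_lt => jS; rewrite -leNgt (bigD1 j) //=.
  by rewrite (le_trans (re_gap_far jn)) // lerDl sumr_ge0 // => *; apply: re_gap_ge0.
apply: contraLR gap_lt; rewrite negb_or => /andP[iS jS].
rewrite -leNgt (bigD1 i) //= (bigD1 j) /=; last by rewrite jS eq_sym ij.
rewrite addrA !re_gap_near // -mulr2n -[_ *+ 2]mulr_natl (le_trans cl_2k3_le) //.
by rewrite lerDl sumr_ge0 // => *; apply: re_gap_ge0.
Qed.

(** * Values of the dominant minors *)

Definition vdm : R[i] := \prod_(i < 2 * alpha) \prod_(j < 2 * alpha | (i < j)%N) (z j - z i).

Lemma vdm_neq0 : vdm != 0.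
Proof.
apply/prodf_neq0 => i _; apply/prodf_neq0 => j ij.
by rewrite subr_eq0 (inj_eq zeta_inj) -val_eqE /= neq_ltn ij orbT.
Qed.

Definition minor (S : {set idx}) : R[i] := \det (split_vandermonde z S).

Lemma cross_diff_minor (S : {set idx}) : #|S| = alpha -> cross_diff z S * minor S = vdm.
Proof. exact: det_split_vandermonde. Qed.

Lemma cross_diff_neq0 (S : {set idx}) : #|S| = alpha -> cross_diff z S != 0.
Proof.
move=> /cross_diff_minor h; apply: contraNneq vdm_neq0 => c0.
by rewrite -h c0 mul0r.
Qed.

(** This is [cross_diff z right_half]; as [right_half] has only 2k elements, no minor is attached to
    it. *)
Definition half_diff : R[i] :=
  \prod_(s in right_half) \prod_(t | t \notin right_half) (z s - z t).

Lemma half_diff_neq0 : half_diff != 0.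
Proof.
apply/prodf_neq0 => s hs; apply/prodf_neq0 => t ht.
by rewrite subr_eq0 (inj_eq zeta_inj); apply: contraNneq ht => <-.
Qed.

Definition kappa : R[i] := - vdm / ((2 * alpha)%:R * half_diff).

Lemma natC_neq0 : (2 * alpha)%:R != 0 :> R[i].
Proof. by rewrite pnatr_eq0; lia. Qed.

Lemma kappa_neq0 : kappa != 0.
Proof.
rewrite mulf_neq0 ?oppr_eq0 ?vdm_neq0 //.
by rewrite invr_eq0 mulf_neq0 ?natC_neq0 ?half_diff_neq0.
Qed.

(** A conjugate pair s, 1/s contributes (x - s)(x - 1/s) = x (x + 1/x - s - 1/s). The minus sign in
    [kappa] comes from x^(2 alpha - 1) = -1/x. *)
Lemma minor_setU1 x : x \notin right_half ->
  minor (x |: right_half) =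
  kappa * z x ^+ alpha *
  (\prod_(j < k) (z x + (z x)^-1 - (2 * cl (2 * j + 1))%:C)) ^+ 2.
Proof.
move=> xr.
have cardU : #|x |: right_half| = alpha by rewrite cardsU1 xr card_right_half; lia.
have prodE : \prod_(s in right_half) (z x - z s) =
    z x ^+ k * \prod_(j < k) (z x + (z x)^-1 - (2 * cl (2 * j + 1))%:C).
  rewrite big_right_half -[k in z x ^+ k]card_ord -prodr_const -big_split /=.
  apply: eq_bigr => j _; rewrite zeta_rev -[2 * _]/(2 * cl (2 * widen_ord (le_k_idx hk) j + 1)).
  by rewrite -zeta_addV; field; rewrite !zeta_neq0.
have := cross_diff_setU1 z xr; rewrite prodE card_right_half // -/half_diff.
rewrite (prod_root_diff x zeta_inj zeta_exp).
have -> : (-1) ^+ (2 * k) = 1 :> R[i] by rewrite exprM sqrrN !expr1n.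
rewrite mul1r.
set D := \prod_(j < k) _ => h.
have zx : z x ^+ (2 * alpha).-1 = - (z x)^-1.
  apply: (mulIf (zeta_neq0 x)); rewrite -exprSr mulNr mulVf ?zeta_neq0 //.
  by rewrite prednK ?zeta_exp //; lia.
rewrite zx in h.
apply: (mulfI (cross_diff_neq0 cardU)); rewrite cross_diff_minor //.
have -> : z x ^+ alpha = (z x ^+ k) ^+ 2 * z x by rewrite exprD expr1 exprM exprAC.
rewrite /kappa; move: natC_neq0 h; move: (2 * alpha)%:R => N N0 h.
transitivity (- (cross_diff z (x |: right_half) * (z x ^+ k * D) ^+ 2) * z x * vdm /
   (N * half_diff)).
  by rewrite h; field; rewrite N0 half_diff_neq0 zeta_neq0.
by field; rewrite N0 half_diff_neq0.
Qed.

(* Complementing the column set and negating all roots leaves [cross_diff] unchanged. *)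
Lemma minor_swap x : x \in right_half ->
  minor (a |: (rev a |: right_half :\ x)) = minor (half_turn hk x |: right_half).
Proof.
move=> xr; set S := _ |: _; set T := _ |: _.
have memT j : (half_turn hk j \in T) = (j \notin S).
  rewrite !inE (inj_eq (inv_inj (half_turnK hk))) -!val_eqE /=.
  rewrite -[(_ %% _)%N]/(half_turn hk j : nat) val_half_turn.
  move: xr; rewrite mem_right_half; have := ltn_ord j; have := ltn_ord x.
  by case: (ltnP j alpha); lia.
have cardT : #|T| = alpha.
  rewrite cardsU1 card_right_half // mem_right_half val_half_turn.
  move: xr; rewrite mem_right_half; have := ltn_ord x.
  by case: (ltnP x alpha) => h1 h2 h3; rewrite (_ : ~~ _ = true); lia.
have cardS : #|S| = alpha.
  have : #|~: S| = alpha.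
    transitivity #|T|; last exact: cardT.
    rewrite -(card_imset T (inv_inj (half_turnK hk))); apply: eq_card => j.
    rewrite [LHS]inE -memT -[in RHS](half_turnK hk j) mem_imset //.
    exact: inv_inj (half_turnK hk).
  by have := cardsC S; rewrite card_ord; lia.
have eqST := cross_diff_opp_compl (half_turnK hk) zeta_half_turn memT.
apply: (mulfI (cross_diff_neq0 cardT)).
by rewrite [RHS]cross_diff_minor // eqST cross_diff_minor.
Qed.

Lemma sl_neg : sl (2 * k + 3) = sl (2 * k - 1).
Proof. by apply: sl_supp => //; lia. Qed.

Lemma cl_neg : cl (2 * k + 3) = - cl (2 * k - 1).
Proof. by apply: cl_supp => //; lia. Qed.

Lemma zeta_n : z n = - cl (2 * k - 1) +i* sl (2 * k - 1).
Proof.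
rewrite zetaE /= (_ : 2 * k.+1 + 1 = 2 * k + 3)%N; last by lia.
by rewrite sl_neg cl_neg.
Qed.

Lemma zeta_rev_n : z (rev n) = - cl (2 * k - 1) -i* sl (2 * k - 1).
Proof.
have := zeta_addV n; rewrite -zeta_rev => /(canRL (addKr _)) ->.
rewrite zeta_n /= (_ : 2 * k.+1 + 1 = 2 * k + 3)%N; last by lia.
rewrite cl_neg; apply/eqP; rewrite eq_complex /=.
by apply/andP; split; apply/eqP; ring.
Qed.

Lemma i_exp_odd m : 'i%C ^+ (2 * m + 1) = (-1) ^+ m * 'i%C :> R[i].
Proof. by rewrite exprD exprM sqr_i. Qed.

Lemma zeta_n_exp : z n ^+ alpha = - (-1) ^+ k * 'i%C.
Proof.
rewrite /zeta exprAC eps_exp_alpha //= (_ : 2 * k.+1 + 1 = (2 * k + 1) + 2)%N; last by lia.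
by rewrite exprD sqr_i i_exp_odd; ring.
Qed.

Lemma zeta_rev_n_exp : z (rev n) ^+ alpha = (-1) ^+ k * 'i%C.
Proof.
rewrite zeta_rev exprVn zeta_n_exp; apply/eqP; rewrite -(inj_eq (@invr_inj _)) invrK.
apply/eqP; have i2 := sqr_i R; have s2 : ((-1) ^+ k) ^+ 2 = 1 :> R[i].
  by rewrite -signr_odd sqrr_sign.
move: ((-1) ^+ k) s2 => s s2.
have si0 : s * 'i%C != 0.
  apply/eqP => h; have : (s * 'i%C) ^+ 2 = -1 by rewrite exprMn s2 i2 mul1r.
  by rewrite h expr0n /= => /eqP; rewrite eq_sym oppr_eq0 oner_eq0.
apply: (mulfI si0); rewrite mulfV //; ring: i2 s2.
Qed.

(** [prod_i] and [prod_n] are the squared product of [minor_setU1] where x + 1/x is 0 (x = i, -i)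
    and -2 c_(2k-1) ([idx_neg] and its conjugate). *)
Definition prod_i : R := \prod_(j < k) (2 * cl (2 * j + 1)) ^+ 2.
Definition prod_n : R := \prod_(j < k) (2 * cl (2 * k - 1) + 2 * cl (2 * j + 1)) ^+ 2.

Lemma minor_i : minor (a |: right_half) = kappa * ((-1) ^+ k * 'i%C) * prod_i%:C.
Proof.
rewrite minor_setU1 ?mem_right_half; last by rewrite /=; lia.
rewrite zeta_i i_exp_odd -zeta_i -zeta_rev zeta_i zeta_Ni subrr /prod_i rmorph_prod -prodrXl.
by congr (_ * _); apply: eq_bigr => j _; rewrite sub0r sqrrN rmorphXn.
Qed.

Lemma minor_Ni : minor (rev a |: right_half) = - kappa * ((-1) ^+ k * 'i%C) * prod_i%:C.
Proof.
rewrite minor_setU1 ?mem_right_half; last by rewrite /=; lia.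
rewrite zeta_rev invrK addrC -zeta_rev zeta_Ni zeta_i subrr.
rewrite [(- 'i%C) ^+ _]exprNn i_exp_odd -[(-1) ^+ alpha]signr_odd oddD oddM /= expr1.
rewrite mulNr mul1r mulNr mulrN /prod_i rmorph_prod -prodrXl.
by congr (_ * _); apply: eq_bigr => j _; rewrite sub0r sqrrN rmorphXn.
Qed.

Lemma prod_nE :
  (\prod_(j < k) (z n + (z n)^-1 - (2 * cl (2 * j + 1))%:C)) ^+ 2 = prod_n%:C.
Proof.
rewrite /prod_n rmorph_prod -prodrXl; apply: eq_bigr => j _.
rewrite zeta_addV /= (_ : 2 * k.+1 + 1 = 2 * k + 3)%N; last by lia.
by rewrite cl_neg -rmorphB -rmorphXn /=; congr _%:C; ring.
Qed.

Lemma minor_n : minor (n |: right_half) = - kappa * ((-1) ^+ k * 'i%C) * prod_n%:C.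
Proof.
rewrite minor_setU1 ?mem_right_half; last by rewrite /=; lia.
by rewrite zeta_n_exp prod_nE; ring.
Qed.

Lemma minor_rev_n : minor (rev n |: right_half) = kappa * ((-1) ^+ k * 'i%C) * prod_n%:C.
Proof.
rewrite minor_setU1 ?mem_right_half; last by rewrite /=; lia.
by rewrite zeta_rev_n_exp zeta_rev invrK [_^-1 + _]addrC prod_nE.
Qed.

Lemma half_turn_pos : half_turn hk p = rev n.
Proof.
apply: val_inj; rewrite [val _]val_half_turn /=; case: ltnP; lia.
Qed.

Lemma half_turn_rev_pos : half_turn hk (rev p) = n.
Proof.
apply: val_inj; rewrite [val _]val_half_turn /=; case: ltnP; lia.
Qed.

Lemma minor_pos : minor (a |: (rev a |: right_half :\ p)) = minor (rev n |: right_half).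
Proof. by rewrite minor_swap ?half_turn_pos // mem_right_half /=; lia. Qed.

Lemma minor_rev_pos : minor (a |: (rev a |: right_half :\ rev p)) = minor (n |: right_half).
Proof. by rewrite minor_swap ?half_turn_rev_pos // mem_right_half /=; lia. Qed.

Lemma sum_zeta_setU1 x : x \notin right_half ->
  \sum_(j in x |: right_half) z j = (gamma1 R k)%:C + z x.
Proof. by move=> xr; rewrite big_setU1 //= sum_zeta_right_half addrC. Qed.

(** The roots i and -i cancel, and removing x amounts to adding its opposite. With [minor_swap],
    such a set contributes the same term as [half_turn hk x |: right_half]. *)
Lemma sum_zeta_swap x : x \in right_half ->
  \sum_(j in a |: (rev a |: right_half :\ x)) z j = (gamma1 R k)%:C + z (half_turn hk x).
Proof.
move=> xr; rewrite !big_setU1 /=; last 2 first.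
- by rewrite !inE -!val_eqE /=; lia.
- by rewrite !inE -!val_eqE /=; lia.
rewrite zeta_i zeta_Ni addNKr zeta_half_turn -sum_zeta_right_half.
by rewrite [in RHS](big_setD1 x) //= addrAC subrr add0r.
Qed.

Lemma det_Amat (mu : R) : \det (Amat alpha mu) =
  \sum_(S : {set idx} | #|S| == alpha) cexp (mu%:C * \sum_(j in S) z j) * minor S.
Proof.
have -> : Amat alpha mu = block_vandermonde z (fun j => cexp (mu%:C * z j)) by [].
rewrite det_block_vandermonde (bigID (fun S : {set idx} => #|S| == alpha)) /=.
rewrite [X in _ + X]big1 ?addr0; last first.
  by move=> S /eqP hS; rewrite det_split_vandermonde_eq0 ?mulr0.
by apply: eq_bigr => S _; congr (_ * _); rewrite mulr_sumr cexp_sum.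
Qed.

Lemma cexpE (x y mu : R) :
  cexp (mu%:C * (x +i* y)) = (expR (x * mu))%:C * (cos (y * mu) +i* sin (y * mu)).
Proof. by rewrite /cexp /= !mul0r subr0 addr0 ![mu * _]mulrC. Qed.

(** Conjugate added roots have opposite minors, so their exponentials combine into 2i times a sine,
    and the factor i in the minors makes this real up to [kappa]. The coefficient 4 rather than 2
    comes from the two swapped sets. *)
Lemma main_sum (mu : R) :
  \sum_(S <- main_cols hk) cexp (mu%:C * \sum_(j in S) z j) * minor S =
  - 2 * kappa * (-1) ^+ k * prod_i%:C * (expR (gamma1 R k * mu))%:C * (sin mu)%:C +
  4 * kappa * (-1) ^+ k * prod_n%:C * (expR (gamma2 R k * mu))%:C *
    (sin (sl (2 * k - 1) * mu))%:C.
Proof.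
have aN : a \notin right_half by rewrite mem_right_half /=; lia.
have raN : rev a \notin right_half by rewrite mem_right_half /=; lia.
have nN : n \notin right_half by rewrite mem_right_half /=; lia.
have rnN : rev n \notin right_half by rewrite mem_right_half /=; lia.
have pr : p \in right_half by rewrite mem_right_half /=; lia.
have rpr : rev p \in right_half by rewrite mem_right_half /=; lia.
rewrite !big_cons big_nil addr0 !sum_zeta_setU1 // !sum_zeta_swap //.
rewrite half_turn_pos half_turn_rev_pos minor_pos minor_rev_pos.
rewrite minor_i minor_Ni minor_n minor_rev_n zeta_i zeta_Ni zeta_n zeta_rev_n.
have g2 : gamma1 R k - cl (2 * k - 1) = gamma2 R k by rewrite /gamma1 /gamma2; ring.
have e1 : (gamma1 R k)%:C + 'i%C = gamma1 R k +i* 1.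
  by apply/eqP; rewrite eq_complex /= addr0 add0r !eqxx.
have e2 : (gamma1 R k)%:C - 'i%C = gamma1 R k +i* (-1).
  by apply/eqP; rewrite eq_complex /= subr0 add0r !eqxx.
have e3 t : (gamma1 R k)%:C + (- cl (2 * k - 1) +i* t) = gamma2 R k +i* t.
  by apply/eqP; rewrite eq_complex /= g2 add0r !eqxx.
rewrite e1 e2 !e3 !cexpE mulN1r mul1r !mulNr !cosN !sinN.
set E1 := (expR (gamma1 R k * mu))%:C; set E2 := (expR (gamma2 R k * mu))%:C.
have cis t u : t +i* u = t%:C + 'i%C * u%:C :> R[i] by rewrite [LHS]complexE.
rewrite !(cis (cos _)) !rmorphN /=.
have i2 := sqr_i R.
by ring: i2.
Qed.

End Roots.

(** * The remainder estimate and the conclusion *)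

Lemma prod_i_gt0 (R : realType) (k : nat) : 0 < prod_i R k.
Proof.
apply: prodr_gt0 => j _; rewrite exprn_gt0 // mulr_gt0 //.
by apply: cl_gt0; have := ltn_ord j; lia.
Qed.

Lemma prod_n_neq0 (R : realType) (k : nat) : prod_n R k != 0.
Proof.
have := prod_cl_ratio R k; rewrite -/(prod_n R k) -/(prod_i R k).
by apply: contra_eqN => /eqP ->; rewrite mul0r lt_eqF // prod_i_gt0.
Qed.

Lemma det_Amat_remainder (R : realType) (k : nat) (hk : (2 <= k)%N) (mu : R) : 0 < mu ->
  cmod (\det (Amat (2 * k + 1) mu) -
     \sum_(S <- main_cols hk) cexp (mu%:C * \sum_(j in S) zeta R j) * minor R S) <=
  (\sum_(S : {set 'I_(2 * (2 * k + 1))}) cmod (minor R S)) * expR (gamma3 R k * mu).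
Proof.
move=> mu0; rewrite det_Amat // (bigID (fun S => S \in main_cols hk)) /=.
rewrite [X in X + _ - _](_ : _ =
  \sum_(S <- main_cols hk) cexp (mu%:C * \sum_(j in S) zeta R j) * minor R S).
  rewrite addrC addKr (le_trans (cmod_sum _ _ _)) // mulr_suml.
  (* The bound sums over all column sets; those outside the remainder only add nonnegative terms. *)
  rewrite [leRHS](bigID (fun S : {set _} => (#|S| == 2 * k + 1)%N && (S \notin main_cols hk))) /=.
  rewrite -[leLHS]addr0 lerD //; last first.
    by apply: sumr_ge0 => S _; rewrite mulr_ge0 ?expR_ge0 // -ler0c cmodE.
  apply: ler_sum => S /andP[/eqP cardS SN]; rewrite cmodM mulrC cmod_cexp.
  rewrite ler_wpM2l -?ler0c ?cmodE // ler_expR.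
  have Re_scale (c : R) (w : R[i]) : complex.Re (c%:C * w) = c * complex.Re w.
    by case: w => x y /=; rewrite mul0r subr0.
  by rewrite Re_scale mulrC ler_pM2r // (re_sum_zeta_le _ cardS SN).
rewrite [RHS]big_uniq ?uniq_main_cols //=; apply: eq_bigl => S.
case: (boolP (S \in main_cols hk)) => [SM|]; last by rewrite andbF.
by rewrite (card_main_cols SM) eqxx.
Qed.

Theorem theorem2p3 (R : realType) (k : nat) (hk : (2 <= k)%N) :
  exists K1 K2 : R[i],
    [/\ K1 != 0, K2 != 0,
        - K2 / K1 = (2 / (sin (pi / (2 * (2 * k + 1))%:R)) ^+ 2)%:C
      & exists (C M : R), forall mu : R, M < mu ->
          cmod (\det (Amat (2 * k + 1) mu)
                - (K1 * (expR (gamma1 R k * mu))%:C * (sin mu)%:C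
                   + K2 * (expR (gamma2 R k * mu))%:C
                        * (sin (sl R (2 * k + 1) (2 * k - 1) * mu))%:C))
          <= C * expR (gamma3 R k * mu)].
Proof.
have kappa0 := kappa_neq0 R hk; have sign0 : (-1) ^+ k != 0 :> R[i] by rewrite signr_eq0.
have prod_i0 : (prod_i R k)%:C != 0 by rewrite (inj_eq (@complexI R)) gt_eqF ?prod_i_gt0.
have prod_n0 : (prod_n R k)%:C != 0 by rewrite (inj_eq (@complexI R)) prod_n_neq0.
(* The coefficients of [main_sum]; [kappa] and the sign cancel in the ratio, leaving
   [2 * (prod_n R k / prod_i R k)]. *)
exists (- 2 * kappa R k * (-1) ^+ k * (prod_i R k)%:C),
  (4 * kappa R k * (-1) ^+ k * (prod_n R k)%:C); split.
- by rewrite (mulf_neq0 (mulf_neq0 (mulf_neq0 _ kappa0) sign0) prod_i0) // oppr_eq0 pnatr_eq0.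
- by rewrite (mulf_neq0 (mulf_neq0 (mulf_neq0 _ kappa0) sign0) prod_n0) // pnatr_eq0.
- have ratio := prod_cl_ratio R k; rewrite -/(prod_n R k) -/(prod_i R k) in ratio.
  have sin0 : sin (pi / (2 * (2 * k + 1))%:R) != 0 :> R.
    have := prod_i_gt0 R k; rewrite -ratio; apply: contraTneq => ->.
    by rewrite expr0n mulr0 ltxx.
  transitivity ((2 * (prod_n R k / prod_i R k))%:C).
    rewrite !(rmorphM, rmorph_nat, fmorphV) /=.
    by field; rewrite kappa0 sign0 prod_i0.
  by congr (_%:C); rewrite -ratio; field; rewrite sin0 prod_n_neq0.
(* The estimate holds for every positive mu, so the threshold is 0. *)
exists (\sum_(S : {set 'I_(2 * (2 * k + 1))}) cmod (minor R S)), 0 => mu mu0.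
by rewrite -(main_sum hk) det_Amat_remainder.
Qed.
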